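(* The Baer-Specker group $\mathbb{Z}^\omega$ is never the union of a chain of proper subgroups with cotorsionfree quotients. That is, for every ordinal $\delta$ and every ascending chain $\langle A_\alpha : \alpha < \delta \rangle$ (so $A_\alpha \subseteq A_\beta$ whenever $\alpha \le \beta < \delta$; the chain is not assumed continuous) of proper subgroups of $\mathbb{Z}^\omega$ such that $\mathbb{Z}^\omega/A_\alpha$ is cotorsionfree for every $\alpha < \delta$, one has $\mathbb{Z}^\omega \neq \bigcup_{\alpha<\delta} A_\alpha$.
   Context: All groups are abelian. $\mathbb{Z}^\omega$ is the direct product of countably many copies of $\mathbb{Z}$. A group $G$ is cotorsion if $\mathrm{Ext}(J,G)=0$ for every torsionfree group $J$ (equivalently $\mathrm{Ext}(\mathbb{Q},G)=0$). A group is cotorsionfree if it has no nonzero cotorsion subgroup; equivalently, it contains no subgroup isomorphic to $\mathbb{Q}$, to $\mathbb{Z}/p\mathbb{Z}$, or to the group $J_p$ of $p$-adic integers, for any prime $p$. *)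

(* Defs.v *)
From HB Require Import structures.
From mathcomp Require Import all_boot all_order all_algebra ring_quotient.
From mathcomp Require Import boolp classical_sets functions wochoice.

Set Implicit Arguments.
Unset Strict Implicit.
Unset Printing Implicit Defensive.

Import GRing.Theory.
Local Open Scope ring_scope.

(* Abelian groups are [zmodType]s. Subgroups of [G] are [zmodClosed G]; these
   are boolean predicates, which classically are arbitrary subsets. The group
   [nat -> int] carries the pointwise structure, and the quotient of [G] by
   [A : zmodClosed G] is [{ideal_quot A}], whose [zmodType] structure does not
   require [A] to be an ideal of a ring. *)

Definition torsion_free (J : zmodType) : Prop :=
  forall (n : nat) (x : J), (0 < n)%N -> x *+ n = 0 -> x = 0.

(* Short exact sequences 0 -> G -> ext_mid -> J -> 0. *)
Record group_ext (J G : zmodType) := GroupExt {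
  ext_mid : zmodType;
  ext_in : {additive G -> ext_mid};
  ext_out : {additive ext_mid -> J};
  ext_in_inj : injective ext_in;
  ext_out_surj : forall j, exists e, ext_out e = j;
  ext_exact : forall e, ext_out e = 0 <-> exists g, ext_in g = e
}.

Definition ext_equiv (J G : zmodType) (E F : group_ext J G) : Prop :=
  exists f : {additive ext_mid E -> ext_mid F},
    [/\ bijective f,
        forall g, f (ext_in E g) = ext_in F g
      & forall e, ext_out F (f e) = ext_out E e].

Section SplitExtension.
Variables J G : zmodType.

Definition split_in (g : G) : G * J := (g, 0).

Fact split_in_is_zmod_morphism : zmod_morphism split_in.
Proof. by move=> x y; congr (_, _); rewrite /= subr0. Qed.

HB.instance Definition _ :=
  GRing.isZmodMorphism.Build G (G * J)%type split_in split_in_is_zmod_morphism.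

Fact split_in_inj : injective split_in.
Proof. by move=> x y []. Qed.

Fact split_out_surj (j : J) : exists e : G * J, e.2 = j.
Proof. by exists (0, j). Qed.

Fact split_exact (e : G * J) : e.2 = 0 <-> exists g, split_in g = e.
Proof. by case: e => g j; split=> [/= -> | [h [_ <-]]//]; exists g. Qed.

Definition split_ext : group_ext J G :=
  @GroupExt J G (G * J)%type split_in snd split_in_inj split_out_surj split_exact.

End SplitExtension.

(* Ext(J, G) is the group of equivalence classes of extensions of J by G under
   the Baer sum, whose zero is the class of the split extension. *)
Definition Ext_eq0 (J G : zmodType) : Prop :=
  forall E : group_ext J G, ext_equiv E (split_ext J G).

Definition cotorsion (G : zmodType) : Prop :=
  forall J : zmodType, torsion_free J -> Ext_eq0 J G.

Section SubgroupType.
Variables (G : zmodType) (H : zmodClosed G).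

Definition subgroup_type : Type := {x : G | x \in H}.

HB.instance Definition _ := SubChoice.on subgroup_type.
HB.instance Definition _ := [SubChoice_isSubZmodule of subgroup_type by <:].

End SubgroupType.

Definition cotorsion_free (G : zmodType) : Prop :=
  forall H : zmodClosed G,
    cotorsion (subgroup_type H) -> forall x, x \in H -> x = 0.

(* Main.v *)
(* By the chain condition and well-ordering, a chain of proper subgroups covering
   Z^omega has a countable cofinal subfamily, provided no member contains all
   unit vectors. The key fact is that every homomorphic image of
   Z^omega / Z^(omega) is cotorsion, so that a homomorphism from Z^omega to a
   cotorsionfree group vanishes as soon as it kills the unit vectors. Hence a
   subgroup with cotorsionfree quotient is the whole group if it contains the
   unit vectors, and in any case is closed in the product topology. By Baire,
   some member of a countable cover contains a neighbourhood of 0, that is almost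
   all unit vectors, and a later member contains all of them. Cotorsionness
   comes from the solvability of h_n = g_n + m_n h_(n+1), which lets Zorn's lemma
   extend partial splittings along torsion-free groups of rank one. *)
Require Import Defs.
From HB Require Import structures.
From mathcomp Require Import all_boot all_order all_algebra ring_quotient.
From mathcomp Require Import boolp classical_sets functions wochoice.

Set Implicit Arguments.
Unset Strict Implicit.
Unset Printing Implicit Defensive.

Import GRing.Theory.

Section GeneralGroups.
Local Open Scope ring_scope.

(** * Subgroups, quotients and torsion-free groups *)

Lemma closed_of_set (G : zmodType) (S : set G) (S0 : S 0)
    (SB : forall x y, S x -> S y -> S (x - y)) :
  {D : zmodClosed G | forall x, x \in D <-> S x}.
Proof.
pose P : {pred G} := fun x => `[< S x >].
have Pclosed : zmod_closed P.
  by split=> [|x y /asboolP Sx /asboolP Sy]; apply/asboolP => //; apply: SB.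
pose PZ := GRing.isZmodClosed.Build G P Pclosed.
pose D : zmodClosed G := HB.pack P PZ.
by exists D => x; split=> /asboolP.
Qed.

Lemma pi_eq0 (G : zmodType) (D : zmodClosed G) (x : G) :
  \pi_{ideal_quot D}%qT x = 0 <-> x \in D.
Proof.
rewrite -[x in x \in D]subr0 Quotient.idealrBE -{1}(raddf0 (\pi_{ideal_quot D}%qT)).
by split=> [->|/eqP].
Qed.

Lemma torsion_free_mulrzI (G : zmodType) (z : int) (x : G) :
  torsion_free G -> x <> 0 -> x *~ z = 0 -> z = 0.
Proof.
move=> tfG x0; case: z => [[|n]|n] //=; first by move/(tfG n.+1 _ isT).
by move/eqP; rewrite NegzE mulrNz oppr_eq0 => /eqP /(tfG n.+1 _ isT).
Qed.

Lemma torsion_free_mulrn_inj (G : zmodType) (n : nat) (x y : G) :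
  torsion_free G -> (0 < n)%N -> x *+ n = y *+ n -> x = y.
Proof.
move=> tfG n0 exy; apply/eqP; rewrite -subr_eq0; apply/eqP/(tfG n) => //.
by rewrite mulrnBl exy subrr.
Qed.

(* [d n] is the lcm of the [i <= n] dividing [x], so that [x_ n] generates the
   elements of the pure hull of [x] with denominator at most [n]. *)
Lemma rank_one_hull (G : zmodType) (x : G) : torsion_free G -> x <> 0 ->
  exists (x_ : nat -> G) (m : nat -> nat),
    [/\ forall n, x_ n <> 0, forall n, x_ n = x_ n.+1 *+ m n
      & forall N n (k : int) (y : G), (0 < N)%N -> y *+ N = x_ n *~ k ->
          exists n' (k' : int), y = x_ n' *~ k'].
Proof.
move=> tfG x0.
pose D N := (0 < N)%N /\ exists y : G, y *+ N = x.
pose fix d n := if n is n'.+1 then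
  if `[< D n'.+1 >] then lcmn (d n') n'.+1 else d n' else 1%N.
have Dlcm M N : D M -> D N -> D (lcmn M N).
  move=> [M0 [y yM]] [N0 [z zN]]; split; first by rewrite lcmn_gt0 M0.
  have [u [v uv]] := Bezoutz M N.
  have g0 : (0 < gcdn M N)%N by rewrite gcdn_gt0 M0.
  (* Multiplied by lcm * gcd = [M * N], this becomes [x] times [u * M + v * N], the gcd, which then
     cancels. *)
  exists (z *~ u + y *~ v); apply: (@torsion_free_mulrn_inj _ (gcdn M N)) => //.
  rewrite -mulrnA muln_lcm_gcd !pmulrn mulrzDl -!mulrzA PoszM.
  rewrite (_ : u * (M%:Z * N%:Z) = N%:Z * (u * M)); last by rewrite [M%:Z * N]mulrC mulrCA.
  rewrite (_ : v * (M%:Z * N%:Z) = M%:Z * (v * N)); last by rewrite mulrCA.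
  by rewrite !(mulrzA _ (Posz _)) -!pmulrn yM zN -mulrzDr uv.
have dD n : D (d n).
  elim: n => [|n IHn] /=; first by split=> //; exists x.
  by case: asboolP => // Dn; apply: Dlcm.
have d_dvd n : (d n %| d n.+1)%N.
  by rewrite /=; case: asboolP => // _; apply: dvdn_lcml.
have dvd_d N : D N -> (N %| d N)%N.
  by case: N => [[]//|N] DN /=; case: asboolP => // _; apply: dvdn_lcmr.
have d0 n : (0 < d n)%N by have [] := dD n.
have [x_ x_P] := choice (fun n => (dD n).2).
have x_0 n : x_ n <> 0 by move=> e; apply: x0; rewrite -(x_P n) e mul0rn.
exists x_, (fun n => d n.+1 %/ d n)%N; split=> // [n|N n k y N0 yN].
  apply: (torsion_free_mulrn_inj tfG (d0 n)).
  by rewrite -mulrnA divnK // !x_P.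
have M0 : (0 < d n * N)%N by rewrite muln_gt0 d0.
have yM : y *+ (d n * N) = x *~ k.
  by rewrite mulnC mulrnA yN pmulrn mulrzAC -pmulrn x_P.
(* In lowest terms [y] is [k' / M'] times [x]. Bezout makes [x] divisible by [M'], so [M'] divides
   [d M'] and [x_ M'] generates [y]. *)
have [u [v uv]] := Bezoutz (d n * N)%N k.
set g := gcdn (d n * N) `|k| in uv.
have g0 : (0 < g)%N by rewrite gcdn_gt0 M0.
have [M' eM] : exists M', (d n * N = M' * g)%N by apply/dvdnP/dvdn_gcdl.
have [k' ek] : exists k', k = k' * g%:Z by apply/dvdzP; rewrite dvdzE dvdn_gcdr.
have M'0 : (0 < M')%N by move: M0; rewrite eM muln_gt0 => /andP[].
pose y' := x *~ u + y *~ v.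
have y'M : y' *+ M' = x.
  apply: (torsion_free_mulrn_inj tfG g0); rewrite -mulrnA -eM (pmulrn y') /y' mulrzDl.
  rewrite mulrzAC -!mulrzA mulrC [v * _]mulrC (mulrzA y) -(pmulrn y) yM.
  by rewrite -mulrzA -mulrzDr [k * v]mulrC uv.
have q_def : (d M' %/ M' * M' = d M')%N by apply/divnK/dvd_d; split=> //; exists y'.
exists M', ((d M' %/ M')%N%:Z * k').
have -> : y = y' *~ k'.
  apply: (torsion_free_mulrn_inj tfG M0); rewrite yM eM ek.
  by rewrite mulrzA mulrnA (pmulrn (_ *~ k')) (mulrzAC _ _ y') -(pmulrn y') y'M -pmulrn.
rewrite mulrzA -pmulrn; congr (_ *~ _).
apply: (torsion_free_mulrn_inj tfG M'0).
by rewrite y'M -mulrnA q_def x_P.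
Qed.

(** * Splitting extensions with torsion-free quotient *)

(* No clause requires [C 0]: the empty set must qualify, being the union of the
   empty chain in Zorn's lemma. *)
Definition pure_complement (E J : zmodType) (out : {additive E -> J})
    (C : set E) : Prop :=
  [/\ forall c d, C c -> C d -> C (c - d), forall c, C c -> out c = 0 -> c = 0
    & forall N e c, (0 < N)%N -> C c -> out e *+ N = out c ->
        exists2 d, C d & out d = out e].

(** This is the vanishing of lim^1 for the tower of copies of [G] with maps [m n], that is, of
    Ext(J, [G]) for J the colimit of copies of Z along the [m n]. *)
Definition triangular_solvable (G : zmodType) : Prop :=
  forall (m : nat -> nat) (g : nat -> G),
    exists h : nat -> G, forall n, h n = g n + h n.+1 *+ m n.

(* With [x_ n] spanning the pure hull of [x] modulo [C + ker out], the errors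
   [x_ n - x_ n.+1 *+ m n] lie in [C + ker out], and solving the triangular
   system in [ker out] corrects the [x_ n] to make these errors lie in [C]. *)
Lemma extend_pure_complement (E J G : zmodType) (out : {additive E -> J})
    (inj : {additive G -> E}) (C : zmodClosed E) (x : E) :
  triangular_solvable G ->
  (forall e, out e = 0 <-> exists g, inj g = e) ->
  pure_complement out [set` C] -> (forall c, c \in C -> out c <> out x) ->
  exists2 C' : set E, pure_complement out C' & ([set` C] `<` C')%classic.
Proof.
move=> solvG exact [_ Cker Cpure] xC.
have [D DP] : {D : zmodClosed E |
    forall e, e \in D <-> exists2 c, c \in C & out c = out e}.
  apply: closed_of_set; first by exists 0; rewrite ?rpred0.
  by move=> a b [c Cc ca] [d Cd db]; exists (c - d); rewrite ?rpredB // !raddfB ca db.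
pose p : {additive E -> {ideal_quot D}} := \pi_{ideal_quot D}%qT.
have p0 e : p e = 0 <-> exists2 c, c \in C & out c = out e.
  by rewrite -DP; apply: pi_eq0.
have pC c : c \in C -> p c = 0 by move=> Cc; apply/p0; exists c.
have px0 : p x <> 0 by move=> /p0 [c /xC].
(* [D] is [C + ker out], and purity of [C] makes the quotient by it torsion-free. *)
have tfQ : torsion_free {ideal_quot D}.
  move=> n z n0; rewrite -[z]reprK -raddfMn => /p0 [c Cc].
  rewrite raddfMn => /esym ec; have [d Cd de] := Cpure _ _ _ n0 Cc ec.
  by apply/p0; exists d.
have [q_ [m [q_0 q_S hull]]] := rank_one_hull tfQ px0.
pose x_ n := repr (q_ n).
have px_ n : p (x_ n) = q_ n by rewrite /p /= reprK.
have /choice [g gP] : forall n, exists g, x_ n - x_ n.+1 *+ m n - inj g \in C.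
  move=> n; have /p0 [c Cc ec] : p (x_ n - x_ n.+1 *+ m n) = 0.
    by rewrite raddfB raddfMn !px_ -q_S subrr.
  have /exact [g ge] : out (x_ n - x_ n.+1 *+ m n - c) = 0 by rewrite raddfB -ec subrr.
  by exists g; rewrite ge opprB addrC subrK.
have [h hP] := solvG m g.
pose y n := x_ n - inj (h n).
have py n : p (y n) = q_ n.
  rewrite raddfB px_; apply/eqP; rewrite subr_eq addrC -subr_eq subrr eq_sym; apply/eqP/p0.
  exists 0; rewrite ?rpred0 // raddf0; apply/esym/exact; by exists (h n).
have yS n : y n - y n.+1 *+ m n \in C.
  suff -> : y n - y n.+1 *+ m n = x_ n - x_ n.+1 *+ m n - inj (g n) by [].
  rewrite /y [in inj (h n)]hP raddfD raddfMn mulrnBl opprB opprD !addrA subrK.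
  by rewrite addrAC.
have yM n t : exists q : nat, y n - y (t + n)%N *+ q \in C.
  elim: t => [|t [q Cq]]; first by exists 1%N; rewrite mulr1n subrr rpred0.
  exists (m (t + n) * q)%N; rewrite addSn -(subrK (y (t + n)%N *+ q) (y n)) -addrA rpredD //.
  by rewrite mulrnA -mulrnBl rpredMn.
(* Modulo [C], the cyclic groups generated by the [y n] ascend; [C'] is the preimage of their
   union. *)
pose C' : set E := fun e => exists n k, e - y n *~ k \in C.
have C'y n e : (exists k, e - y n *~ k \in C) -> forall t, exists k, e - y (t + n)%N *~ k \in C.
  move=> [k Ck] t; have [q Cq] := yM n t; exists (q%:Z * k).
  rewrite mulrzA -pmulrn -(subrK (y n *~ k) e) -addrA rpredD //.
  by rewrite -mulrzBl rpredMz.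
exists C'; last first.
  split=> [c Cc | /(_ (y 0%N)) y0C].
    by exists 0%N, 0; rewrite mulr0z subr0.
  apply: (q_0 0%N); rewrite -py; apply/pC/y0C.
  by exists 0%N, 1; rewrite mulr1z subrr rpred0.
split.
- move=> c d [n [k Ck]] [n' [k' Ck']].
  have [i Ci] := C'y _ _ (ex_intro _ k Ck) n'.
  have [j Cj] := C'y _ _ (ex_intro _ k' Ck') n.
  exists (n' + n)%N, (i - j).
  rewrite mulrzBr opprB [_ - y _ *~ i]addrC addrACA [- d + _]addrC -[_ *~ j - d]opprB.
  by rewrite rpredB // addnC.
- move=> c [n [k Ck]] oc.
  have pc : p c = 0 by apply/p0; exists 0; rewrite ?rpred0 // raddf0.
  have := pC _ Ck; rewrite raddfB pc sub0r raddfMz py => /eqP; rewrite oppr_eq0 => /eqP qk.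
  move: Ck; rewrite (torsion_free_mulrzI tfQ (q_0 n) qk) mulr0z subr0 => Cc.
  exact: Cker.
- move=> N e c N0 [n [k Ck]] ec.
  have pN : p e *+ N = q_ n *~ k.
    rewrite -py -raddfMz -raddfMn; apply/eqP; rewrite -subr_eq0 -raddfB; apply/eqP/p0.
    exists (c - y n *~ k) => //.
    by rewrite !raddfB -ec !raddfMn.
  have [n' [k' pe]] := hull _ _ _ _ N0 pN.
  have /p0 [d Cd de] : p (e - y n' *~ k') = 0 by rewrite raddfB raddfMz py pe subrr.
  exists (d + y n' *~ k').
    by exists n', k'; rewrite addrK.
  by rewrite raddfD de raddfB subrK.
Qed.


(** A maximal pure partial complement maps onto [J]: an element outside its image would allow a
    proper extension. *)
Lemma pure_complement_exists (E J G : zmodType) (out : {additive E -> J})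
    (inj : {additive G -> E}) :
  torsion_free J -> triangular_solvable G ->
  (forall e, out e = 0 <-> exists g, inj g = e) ->
  exists C : zmodClosed E, (forall c, c \in C -> out c = 0 -> c = 0) /\
    forall e, exists2 c, c \in C & out c = out e.
Proof.
move=> tfJ solvG exact.
have [F FP Ftot|C [[CB Cker Cpure] Cmax]] := @Zorn_bigcup E (pure_complement out).
  split.
  - move=> c d [X FX Xc] [Y FY Yd]; have [XY|YX] := Ftot _ _ FX FY.
      by exists Y => //; have [YB _ _] := FP _ FY; apply: YB => //; apply: XY.
    by exists X => //; have [XB _ _] := FP _ FX; apply: XB => //; apply: YX.
  - by move=> c [X FX Xc]; have [_ Xker _] := FP _ FX; apply: Xker.
  - move=> N e c N0 [X FX Xc] ec; have [_ _ Xpure] := FP _ FX.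
    by have [d Xd de] := Xpure _ _ _ N0 Xc ec; exists d => //; exists X.
(* A maximal [C] is nonempty because {0} qualifies, its purity being the torsion-freeness of [J]. *)
have C0 : C 0.
  apply: contrapT => nC0.
  have C_empty c : ~ C c by move=> Cc; apply: nC0; rewrite -(subrr c); apply: CB.
  apply: (Cmax [set 0]%classic); first by split=> [c /C_empty//|/(_ 0 erefl)].
  split=> [_ _ -> -> | _ -> // | N e _ N0 ->]; first by rewrite subrr.
  by rewrite raddf0 => /(tfJ _ _ N0) ->; exists 0; rewrite ?raddf0.
have [D DC] := closed_of_set C0 CB.
have CD : C = [set` D]%classic by apply/seteqP; split=> c /DC.
exists D; split=> [c /DC|e]; first exact: Cker.
apply: contrapT => ne.
have De c : c \in D -> out c <> out e by move=> Dc ce; apply: ne; exists c.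
have pD : pure_complement out [set` D]%classic by rewrite -CD.
have [C' C'P] := extend_pure_complement solvG exact pD De.
by rewrite -CD => /Cmax; apply.
Qed.

(** Projecting along the complement [C] gives a retraction [r] onto [G], and [r] paired with [out]
    is the splitting. *)
Lemma triangular_solvable_cotorsion (G : zmodType) :
  triangular_solvable G -> cotorsion G.
Proof.
move=> solvG J tfJ [E inj out inj_inj out_surj exact].
have [C [Cker Cfull]] := pure_complement_exists tfJ solvG exact.
have /choice [r rC] : forall e, exists g, e - inj g \in C.
  move=> e; have [c Cc ce] := Cfull e.
  have /exact [g ge] : out (e - c) = 0 by rewrite raddfB ce subrr.
  by exists g; rewrite ge opprB addrC subrK.
have out_inj g : out (inj g) = 0 by apply/exact; exists g.
have r_unique e g : e - inj g \in C -> r e = g.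
  move=> Cg; apply: inj_inj; apply/eqP; rewrite -subr_eq0; apply/eqP/Cker.
    have -> : inj (r e) - inj g = (e - inj g) - (e - inj (r e)).
      by rewrite opprB [RHS]addrC addrA subrK.
    exact: rpredB.
  by rewrite raddfB !out_inj subrr.
pose f e : G * J := (r e, out e).
have f_additive : zmod_morphism f.
  move=> a b; rewrite /f [out _]raddfB; congr (_, _); apply: r_unique.
  rewrite raddfB opprB [inj (r b) - _]addrC addrACA [- b + _]addrC -[_ - b]opprB.
  by rewrite rpredB.
pose fA : {additive E -> (G * J)%type} :=
  HB.pack f (GRing.isZmodMorphism.Build E (G * J)%type f f_additive).
have f_in g : f (inj g) = (g, 0).
  by congr (_, _) => //; apply: r_unique; rewrite subrr rpred0.
exists fA; split=> //=.
have /choice [s0 outs0] := out_surj.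
have /choice [c cP] : forall j, exists d, d \in C /\ out d = j.
  by move=> j; have [d Cd dj] := Cfull (s0 j); exists d; rewrite dj outs0.
exists (fun u : G * J => inj u.1 + c u.2) => [e|[g j]] /=.
  have [Cc ce] := cP (out e); apply/eqP; rewrite -subr_eq0; apply/eqP/Cker.
    by rewrite addrAC addrC -[_ - e]opprB rpredB.
  by rewrite raddfB raddfD out_inj ce add0r subrr.
have [Cc cj] := cP j.
rewrite /f raddfD out_inj cj add0r; congr (_, _); apply: r_unique.
by rewrite addrAC subrr add0r.
Qed.

(** * Homomorphisms out of Z^omega *)

Lemma funMrz (f : nat -> int) (k : int) (i : nat) : (f *~ k) i = f i *~ k.
Proof.
have funMn n : (f *+ n) i = f i *+ n.
  by elim: n => [|n IHn]; rewrite ?mulr0n // !mulrS -IHn.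
by case: k => n; rewrite ?NegzE ?mulrNz -!pmulrn -funMn.
Qed.

Definition unit_vector (n : nat) : nat -> int := fun i => (i == n)%:R.

Lemma finite_support_eq0 (G : zmodType) (f : {additive (nat -> int) -> G}) :
  (forall n, f (unit_vector n) = 0) ->
  forall n x, (forall i, (n <= i)%N -> x i = 0) -> f x = 0.
Proof.
move=> f0; elim=> [|n IHn] x x0.
  by rewrite (_ : x = 0) ?raddf0 //; apply/funext => i; apply: x0.
rewrite -(subrK (unit_vector n *~ x n) x) raddfD (raddfMz f) f0 mul0rz addr0.
apply: IHn => i; rewrite leq_eqVlt.
have -> : (x - unit_vector n *~ x n) i = x i - (i == n)%:R *~ x n.
  by rewrite -[_ *~ _ in RHS](funMrz (unit_vector n)).
by case: eqVneq => [->|_ /x0 ->] //=; rewrite ?intz ?mul0rz ?subrr.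
Qed.

(* In each coordinate [k] the system is solved downwards, starting from 0 above
   index [k]; the equation number [n] then only fails at coordinates [k < n]. *)
Lemma image_cotorsion (G : zmodType) (f : {additive (nat -> int) -> G})
    (H : zmodClosed G) :
  (forall n, f (unit_vector n) = 0) -> (forall y, y \in H <-> exists x, f x = y) ->
  cotorsion (subgroup_type H).
Proof.
move=> f0 HP; apply: triangular_solvable_cotorsion => m g.
have /choice [a aP] : forall n, exists x, f x = val (g n).
  by move=> n; apply/HP/valP.
pose fix s (t n k : nat) {struct t} : int := if t is t'.+1 then a n k + s t' n.+1 k *+ m n else 0.
(* The recursion runs through the indices from [n] to [k]; for [n <= k], passing to [n.+1] uses
   exactly one step less. *)
pose h n k := s (k.+1 - n)%N n k.
have fh n : f (h n) \in H by apply/HP; exists (h n).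
exists (fun n => Sub (f (h n)) (fh n)) => n; apply: val_inj.
rewrite raddfD raddfMn /= -aP -raddfMn -raddfD.
apply/eqP; rewrite -subr_eq0 -raddfB; apply/eqP/(finite_support_eq0 f0 (n := n)) => k nk.
rewrite pmulrn.
have -> : (h n - (a n + h n.+1 *~ m n)) k = h n k - (a n k + h n.+1 k *~ m n).
  by rewrite -funMrz.
by rewrite {1}/h subSn //= pmulrn subrr.
Qed.

Lemma cotorsion_free_null (G : zmodType) (f : {additive (nat -> int) -> G}) :
  cotorsion_free G -> (forall n, f (unit_vector n) = 0) -> forall x, f x = 0.
Proof.
move=> cfG f0 x.
have [H HP] : {H : zmodClosed G | forall y, y \in H <-> exists x, f x = y}.
  apply: closed_of_set; first by exists 0; rewrite raddf0.
  by move=> _ _ [u <-] [v <-]; exists (u - v); rewrite raddfB.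
by apply: (cfG H (image_cotorsion f0 HP)); apply/HP; exists x.
Qed.

(* The differences [b n] of the approximations [a n] of [x] tend to 0, so
   [y |-> \sum_n y n * b n] is a well-defined endomorphism; it maps unit vectors
   into [A] and the constant sequence 1 to [x]. *)
Lemma cotorsion_free_quot_closed (A : zmodClosed (nat -> int)) (x : nat -> int) :
  cotorsion_free {ideal_quot A} ->
  (forall n, exists2 a, a \in A & forall i, (i < n)%N -> a i = x i) -> x \in A.
Proof.
move=> cfA xA.
have /choice [a aP] : forall n, exists a, a \in A /\ forall i, (i < n)%N -> a i = x i.
  by move=> n; have [a Aa ax] := xA n; exists a.
have aA n : a n \in A by have [] := aP n.
have ax n i : (i < n)%N -> a n i = x i by have [_] := aP n; apply.
pose b n : nat -> int := if n is n'.+1 then a n'.+1 - a n' else a 0%N.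
have bA n : b n \in A by case: n => [|n] /=; rewrite ?rpredB.
have b0 n i : (i.+1 < n)%N -> b n i = 0.
  case: n => [//|n]; rewrite ltnS => ni; rewrite /= !fctE !ax ?subrr //.
  exact: leqW.
have sum_b n i : \sum_(k < n.+1) b k i = a n i.
  elim: n => [|n IHn]; first by rewrite big_ord1.
  by rewrite big_ord_recr IHn /= !fctE addrC subrK.
(* The bound [i.+2] suffices: [b k i] vanishes for [k > i.+1], as both approximations then agree
   with [x] at [i]. *)
pose phi (y : nat -> int) : nat -> int := fun i => \sum_(k < i.+2) b k i * y k.
have phiB : zmod_morphism phi.
  move=> y z; apply/funext => i; rewrite !fctE -sumrB.
  by apply: eq_bigr => k _; rewrite -mulrBr.
pose f : {additive (nat -> int) -> (nat -> int)} :=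
  HB.pack phi (GRing.isZmodMorphism.Build _ _ phi phiB).
have f_unit n : f (unit_vector n) = b n.
  apply/funext => i; rewrite /= /phi.
  under eq_bigr do rewrite mulr_natr mulrb.
  rewrite -big_mkcond (big_ord1_eq _ (fun k => b k i)) /=.
  by case: ltnP => // /b0.
have fx : f (fun=> 1) = x.
  apply/funext => i; rewrite /= /phi; under eq_bigr do rewrite mulr1.
  by rewrite sum_b ax.
rewrite -fx; apply/pi_eq0.
apply: (cotorsion_free_null (f := \pi_{ideal_quot A}%qT \o f) cfA) => n.
by apply/pi_eq0; rewrite f_unit.
Qed.

(** * Baire category in Z^omega *)

(** If no [B k] contains a ball, nested balls can be chosen so that the one built at stage [k]
    misses [B k]; their centres converge to an uncovered point. *)
Lemma countable_closed_cover (B : nat -> set (nat -> int)) :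
  (forall k x, (forall n, exists2 y, B k y & forall i, (i < n)%N -> y i = x i) ->
     B k x) ->
  (forall x, exists k, B k x) ->
  exists k m x, forall z, (forall i, (i < m)%N -> z i = x i) -> B k z.
Proof.
move=> Bclosed Bcover; apply: contrapT => noball.
have /choice [step stepP] : forall u : nat * (nat * (nat -> int)),
    exists v : nat * (nat -> int), [/\ (u.2.1 < v.1)%N,
      forall i, (i < u.2.1)%N -> v.2 i = u.2.2 i
    & forall z, (forall i, (i < v.1)%N -> z i = v.2 i) -> ~ B u.1 z].
  move=> [k [m x]] /=; apply: contrapT => nv; apply: noball.
  exists k, m, x => z zx; apply: Bclosed => n; apply: contrapT => nz; apply: nv.
  (* No point of [B k] agrees with [z] below [n], so this ball misses [B k]; [m.+1] forces the radii
     to shrink. *)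
  exists (maxn m.+1 n, z); split=> //=; first by rewrite leq_max leqnn.
  move=> y yz By; apply: nz; exists y => // i ni; apply: yz.
  by rewrite leq_max ni orbT.
pose fix u k := if k is k'.+1 then step (k', u k') else (0%N, fun=> 0) : nat * (nat -> int).
have u_mono k : ((u k).1 < (u k.+1).1)%N by have [] := stepP (k, u k).
have u_ge k : (k <= (u k).1)%N by elim: k => // k IHk; apply: leq_trans (u_mono k).
have u_agree k t i : (i < (u k).1)%N -> (u (t + k)%N).2 i = (u k).2 i.
  move=> ik; elim: t => // t <-.
  have [_ agree _] := stepP ((t + k)%N, u (t + k)%N); apply: agree => /=.
  apply: leq_trans ik _; elim: (t) => // s IHs.
  by apply: leq_trans IHs _; apply/ltnW/u_mono.
pose x i := (u i.+1).2 i.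
have xu k i : (i < (u k).1)%N -> x i = (u k).2 i.
  move=> ik; rewrite /x -(u_agree _ k _ (u_ge i.+1)) -(u_agree _ i.+1 _ ik).
  by rewrite addnC.
have [k Bk] := Bcover x.
have [_ _ avoid] := stepP (k, u k).
by apply: (avoid x) => // i; apply: (xu k.+1).
Qed.

End GeneralGroups.

(** * Chains of subgroups covering Z^omega *)

Lemma well_order_total (T : Type) (R : rel T) : well_order R -> total R.
Proof.
move=> Rwo a b; pose P : {pred T} := fun x => `[< x = a \/ x = b >].
have Pa : a \in P by apply/asboolP; left.
have Pb : b \in P by apply/asboolP; right.
have [|z [[/asboolP[]-> lbz] _]] := Rwo P; first by exists a.
  by rewrite (lbz b Pb).
by rewrite (lbz a Pa) orbT.
Qed.

Local Open Scope classical_set_scope.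

Theorem theorem1p4 (delta : Type) (le : rel delta)
    (A : delta -> zmodClosed (nat -> int)) :
  well_order le ->
  (forall a b, le a b -> [set` A a] `<=` [set` A b]) ->
  (forall a, [set` A a] <> [set: nat -> int]) ->
  (forall a, cotorsion_free {ideal_quot (A a)}) ->
  [set: nat -> int] <> \bigcup_(a in [set: delta]) [set` A a].
Proof.
move=> le_wo A_mono A_proper cfA cover.
have A_chain a b : [set` A a] `<=` [set` A b] \/ [set` A b] `<=` [set` A a].
  by have /orP[/A_mono|/A_mono] := well_order_total le_wo a b; [left|right].
have A_cover x : exists a, x \in A a.
  have : [set: nat -> int] x by [].
  by rewrite cover => -[a _ Aa]; exists a.
have unit_notin a : exists n, unit_vector n \notin A a.
  apply: contrapT => An; apply: (A_proper a); apply/seteqP; split=> // x _ /=.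
  apply/pi_eq0.
  apply: (cotorsion_free_null (f := \pi_{ideal_quot (A a)}%qT) (cfA a)) => n.
  by apply/pi_eq0; apply: contrapT => nA; apply: An; exists n; apply/negP.
have /choice [a_ a_P] := fun n => A_cover (unit_vector n).
have a_cover x : exists k, x \in A (a_ k).
  (* [A b] omits a unit vector that [A (a_ n)] contains, so the chain condition puts [A b] inside
     [A (a_ n)]. *)
  have [b Ab] := A_cover x; have [n nb] := unit_notin b; exists n.
  have [|sub] := A_chain b (a_ n); first exact.
  by move: nb; rewrite (sub _ (a_P n)).
have [k|k [m [x ball]]] := countable_closed_cover _ a_cover.
  by move=> x; apply: cotorsion_free_quot_closed.
have tail i : (m <= i)%N -> unit_vector i \in A (a_ k).
  (* Both [x] and its translate by the unit vector lie in the ball. *)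
  move=> mi; rewrite -(addrK x (unit_vector i)) rpredB ?ball // => j jm.
  by rewrite !fctE /unit_vector (ltn_eqF (leq_trans jm mi)) add0r.
have [b [kb init]] : exists b, [set` A (a_ k)] `<=` [set` A b] /\
    forall i, (i < m)%N -> unit_vector i \in A b.
  (* [b] is the index of the largest among [A (a_ k)] and the [A (a_ i)] with [i < m]. *)
  elim: (m) => [|n [b [kb IHb]]]; first by exists (a_ k); split=> // y.
  have [sub|sub] := A_chain b (a_ n).
    exists (a_ n); split=> [y /kb/sub//|i].
    by rewrite ltnS leq_eqVlt => /orP[/eqP ->|/IHb/sub].
  exists b; split=> // i; rewrite ltnS leq_eqVlt => /orP[/eqP ->|/IHb//].
  exact/sub/a_P.
have [n /negP] := unit_notin b; apply.
by have [/init|/tail/kb] := ltnP n m.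
Qed.
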